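(* Let $A$ and $B$ be arbitrary non-empty sets, and let $\mathcal{T}$ be a set of $A$-to-$B$ relational constraints. Then the following are equivalent: (i) $\mathcal{T}$ is locally closed, contains the unary empty constraint $(\emptyset,\emptyset)$ and the unary trivial constraint $(A,B)$, and is closed under formation of conjunctive minors; (ii) $\mathcal{T}$ is characterized by some set of total multivalued functions on $A$ to $B$.
   Context: Conventions: $n,m,\dots$ denote positive integers, viewed as ordinals $n=\{0,\dots,n-1\}$; an $m$-tuple over $A$ is a map $m\to A$. An $m$-ary relation on $A$ is a subset of $A^m$; empty relations of different arities are regarded as distinct. Multivalued functions: an $n$-ary multivalued function on $A$ to $B$ is a map $f:A^n\to\mathcal{P}(B)$, where $\mathcal{P}(B)$ is the set of all subsets of $B$; it is total if $f(\mathbf{a})\neq\emptyset$ for every $\mathbf{a}\in A^n$. For $\mathbf{a}^1,\dots,\mathbf{a}^n\in A^m$, let $f(\mathbf{a}^1\ldots\mathbf{a}^n)=\prod_{i\in m}f(\mathbf{a}^1(i),\dots,\mathbf{a}^n(i))\subseteq B^m$, and for $R\subseteq A^m$ let $fR=\bigcup\{f(\mathbf{a}^1\ldots\mathbf{a}^n):\mathbf{a}^1,\dots,\mathbf{a}^n\in R\}$. Constraints: an $m$-ary $A$-to-$B$ (relational) constraint is an ordered pair $(R,S)$ with $R\subseteq A^m$ (antecedent) and $S\subseteq B^m$ (consequent); all constraints have finite arity. $f$ satisfies $(R,S)$ if $fR\subseteq S$. A set $\mathcal{T}$ of $A$-to-$B$ constraints (of various arities) is characterized by a set $\mathcal{M}$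 of multivalued functions (of various arities) if $\mathcal{T}$ is exactly the set of all $A$-to-$B$ constraints satisfied by every function in $\mathcal{M}$. Conjunctive minors: a minor formation scheme with target $m$, indeterminate set $V$ (an arbitrary, possibly empty or infinite, set disjoint from $m$ and from all $n_j$) and source family $(n_j)_{j\in J}$ (a non-empty family of positive integers) is a family $H=(h_j)_{j\in J}$ of maps $h_j:n_j\to m\cup V$. For $\mathbf{a}:m\to A$ and $\sigma:V\to A$, $\mathbf{a}+\sigma:m\cup V\to A$ is the map agreeing with $\mathbf{a}$ on $m$ and with $\sigma$ on $V$, and $(\mathbf{a}+\sigma)h_j:n_j\to A$ is its composite with $h_j$ (similarly for $B$). An $m$-ary constraint $(R,S)$ is a conjunctive minor of a non-empty family $(R_j,S_j)_{j\in J}$ of constraints, $(R_j,S_j)$ of arity $n_j$, if for some such scheme $H$, for all $\mathbf{a}\in A^m$, $\mathbf{b}\in B^m$: (a) $\mathbf{a}\in R$ implies there is $\sigma_A:V\to A$ with $(\mathbf{a}+\sigma_A)h_j\in R_j$ for all $j\in J$; and (b) if there is $\sigma_B:V\to B$ with $(\mathbf{b}+\sigma_B)h_j\in S_j$ for all $j\in J$, then $\mathbf{b}\in S$. $\mathcal{T}$ is closed under formation of conjunctive minors if every conjunctive minor of any non-empty family of members of $\mathcal{T}$ is in $\mathcal{T}$. Local closure: $(R',S')$ is a relaxation of $(R,S)$ (of the same arity) if $R'\subseteq R$ and $S'\supseteq S$; it is a finite relaxation if moreover $R'$ is finite. $\mathcal{T}$ is locally closed if it contains every $A$-to-$B$ constraint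 all of whose finite relaxations belong to $\mathcal{T}$. *)

(* Defs.v *)
From mathcomp Require Import all_boot.
From mathcomp Require Import boolp classical_sets functions cardinality.

Set Implicit Arguments.
Unset Strict Implicit.
Unset Printing Implicit Defensive.

Local Open Scope classical_set_scope.

(* An m-tuple over X is a map 'I_m -> X, and an m-ary relation on X is a
   set ('I_m -> X); arities are positive. *)

Record constraint (A B : Type) : Type := Constraint {
  arity : nat;
  arity_gt0 : (0 < arity)%N;
  antecedent : set ('I_arity -> A);
  consequent : set ('I_arity -> B) }.

Arguments antecedent {A B} c _ : rename.
Arguments consequent {A B} c _ : rename.

Record multifun (A B : Type) : Type := Multifun {
  mf_arity : nat;
  mf_arity_gt0 : (0 < mf_arity)%N;
  mf_app :> ('I_mf_arity -> A) -> set B }.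

Arguments mf_app {A B} f _ _ : rename.

Definition mf_total (A B : Type) (f : multifun A B) : Prop :=
  forall a : 'I_(mf_arity f) -> A, f a !=set0.

Definition mf_tuples (A B : Type) (f : multifun A B) (m : nat)
    (a : 'I_(mf_arity f) -> 'I_m -> A) : set ('I_m -> B) :=
  [set b | forall i : 'I_m, f (fun k => a k i) (b i)].

Arguments mf_tuples {A B} f {m} a _.

Definition mf_image (A B : Type) (f : multifun A B) (m : nat)
    (R : set ('I_m -> A)) : set ('I_m -> B) :=
  \bigcup_(a in [set a : 'I_(mf_arity f) -> 'I_m -> A | forall k, R (a k)])
    mf_tuples f a.

Definition satisfies (A B : Type) (f : multifun A B) (c : constraint A B) :
  Prop := mf_image f (antecedent c) `<=` consequent c.

Definition characterized_by (A B : Type) (T : set (constraint A B))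
    (M : set (multifun A B)) : Prop :=
  T = [set c | forall f, M f -> satisfies f c].

Definition unary_empty (A B : Type) : constraint A B :=
  @Constraint A B 1 (ltn0Sn 0) set0 set0.

Definition unary_trivial (A B : Type) : constraint A B :=
  @Constraint A B 1 (ltn0Sn 0) setT setT.

(* a + s; the disjoint union of m and V is the sum type 'I_m + V *)
Definition extend (X V : Type) (m : nat) (a : 'I_m -> X) (s : V -> X)
    (x : 'I_m + V) : X :=
  match x with inl i => a i | inr v => s v end.

Definition scheme (A B J : Type) (m : nat) (V : Type)
    (F : J -> constraint A B) : Type :=
  forall j : J, 'I_(arity (F j)) -> 'I_m + V.

Definition conj_minor_via (A B J V : Type) (c : constraint A B)
    (F : J -> constraint A B) (h : scheme (arity c) V F) : Prop :=
  (forall a : 'I_(arity c) -> A, antecedent c a ->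
     exists s : V -> A, forall j, antecedent (F j) (extend a s \o h j)) /\
  (forall b : 'I_(arity c) -> B,
     (exists s : V -> B, forall j, consequent (F j) (extend b s \o h j)) ->
     consequent c b).

Definition conj_minor (A B J : Type) (c : constraint A B)
    (F : J -> constraint A B) : Prop :=
  exists (V : Type) (h : scheme (arity c) V F), conj_minor_via h.

Definition closed_conj_minors (A B : Type) (T : set (constraint A B)) : Prop :=
  forall (J : Type) (F : J -> constraint A B) (c : constraint A B),
    inhabited J -> (forall j, T (F j)) -> conj_minor c F -> T c.

(* Having the same arity is expressed by building c' on the arity of c. *)
Definition finite_relaxation (A B : Type) (c' c : constraint A B) : Prop :=
  exists (R' : set ('I_(arity c) -> A)) (S' : set ('I_(arity c) -> B)),
    [/\ c' = Constraint (arity_gt0 c) R' S', R' `<=` antecedent c,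
        consequent c `<=` S' & finite_set R'].

Definition locally_closed (A B : Type) (T : set (constraint A B)) : Prop :=
  forall c : constraint A B, (forall c', finite_relaxation c' c -> T c') -> T c.

(* Main.v *)
(* For the converse direction, let a constraint outside T be given. Local closure
   yields a relaxation (R', S') outside T with R' = {a_0, ..., a_(n-1)} finite, and
   n > 0 because every constraint with empty antecedent is a minor of the unary empty
   one. Take the indeterminates to be the points of A^n, and send each
   i in m to the point (a_0 i, ..., a_(n-1) i) of A^n and each indeterminate to
   itself. Use as sources all members of T, along all maps h for which every
   coordinate of the composite lies in the antecedent. The resulting minor cannot
   force S', so some b outside S' extends to the indeterminates compatibly with all
   sources. Collecting the values of this extension over each point of A^n gives a
   multivalued function; it is total because every point is an indeterminate. *)
Require Import Defs.
From mathcomp Require Import all_boot.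
From mathcomp Require Import boolp classical_sets functions cardinality.

Set Implicit Arguments.
Unset Strict Implicit.

Local Open Scope classical_set_scope.

Lemma finite_set_range_ord (X : Type) (R : set X) :
  finite_set R -> exists (n : nat) (g : 'I_n -> X), R = range g.
Proof.
move=> /(@finite_seqP {classic X}) [s ->]; exists (size s), (tnth (in_tuple s)).
apply/seteqP; split => [x /= xs|_ [i _ <-]]; last exact: mem_tnth.
by have /tnthP [i ->] : x \in in_tuple s by []; exists i.
Qed.

Lemma satisfies_relaxation (A B : Type) (f : multifun A B) (c : constraint A B)
    (R' : set ('I_(arity c) -> A)) (S' : set ('I_(arity c) -> B)) :
  R' `<=` antecedent c -> consequent c `<=` S' ->
  satisfies f c -> satisfies f (Constraint (arity_gt0 c) R' S').
Proof.
by move=> RR SS fc b [a Ra fab]; apply/SS/fc; exists a => // k; apply/RR/Ra.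
Qed.

Lemma satisfies_unary_empty (A B : Type) (f : multifun A B) :
  satisfies f (unary_empty A B).
Proof. by move=> b [a Ra _]; case: (Ra (Ordinal (mf_arity_gt0 f))). Qed.

(** A tuple in $fR$ arises from only [mf_arity f] tuples of $R$, so the relaxation with antecedent
    [range a] already decides it. *)
Lemma satisfies_finite_relaxations (A B : Type) (f : multifun A B)
    (c : constraint A B) :
  (forall c', finite_relaxation c' c -> satisfies f c') -> satisfies f c.
Proof.
move=> fc b [a Ra fab].
have /fc : finite_relaxation
    (Constraint (arity_gt0 c) (range a) (consequent c)) c.
  exists (range a), (consequent c); split=> //; first by move=> _ [k _ <-].
  by apply: finite_image; exact: finite_finset.
by apply; exists a => // k; exists k.
Qed.

Lemma satisfies_conj_minor (A B J : Type) (f : multifun A B)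
    (c : constraint A B) (F : J -> constraint A B) :
  mf_total f -> (forall j, satisfies f (F j)) -> conj_minor c F ->
  satisfies f c.
Proof.
move=> ft fF [V [h [hR hS]]] b [a Ra fab]; apply: hS.
have [s sP] := choice (fun k => hR (a k) (Ra k)).
(* Totality lets [t v] be picked from the value of [f] at the point [(s k v)_k]. *)
have [t tP] := choice (fun v => ft (fun k => s k v)).
exists t => j; apply: fF; exists (fun k => extend (a k) (s k) \o h j) => [k|i /=].
- exact: sP.
- by case: (h j i) => [l|v] /=; [exact: fab | exact: tP].
Qed.

Lemma conj_minor_unary_empty (A B : Type) (m : nat) (m0 : (0 < m)%N)
    (S : set ('I_m -> B)) :
  conj_minor (Constraint m0 (set0 : set ('I_m -> A)) S)
    (fun _ : unit => unary_empty A B).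
Proof.
exists void, (fun _ _ => inl (Ordinal m0)); split => [a []|b [s]].
by case/(_ tt).
Qed.

Section Separation.
Variables (A B : Type) (T : set (constraint A B)) (m n : nat).
Variable a : 'I_n -> 'I_m -> A.

Definition column (u : 'I_m + ('I_n -> A)) (k : 'I_n) : A :=
  extend (a k) (fun v => v k) u.

Definition column_source : Type :=
  {c : constraint A B & {h : 'I_(arity c) -> 'I_m + ('I_n -> A) |
     T c /\ forall k, antecedent c (column^~ k \o h)}}.

Definition column_constraint (j : column_source) : constraint A B := projT1 j.

Definition column_scheme : scheme m ('I_n -> A) column_constraint :=
  fun j => sval (projT2 j).
Arguments column_scheme : clear implicits.

Lemma conj_minor_column (m0 : (0 < m)%N) (S : set ('I_m -> B)) :
  (forall b t,
    (forall j, consequent (column_constraint j) (extend b t \o column_scheme j)) ->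
    S b) ->
  conj_minor (Constraint m0 (range a) S) column_constraint.
Proof.
move=> HS; exists ('I_n -> A), column_scheme; split => [_ [k _ <-]|b [t]]; last exact: HS.
(* Extending [a k] by the [k]-th projection gives [column^~ k] by conversion. *)
exists (fun v => v k) => -[c [h [Tc hR]]]; exact: hR.
Qed.

Definition column_fun (n0 : (0 < n)%N) (e : 'I_m + ('I_n -> A) -> B) :
    multifun A B :=
  Multifun n0 (fun x => [set e u | u in [set u | column u = x]]).

Lemma column_fun_total n0 e : mf_total (column_fun n0 e).
Proof. by move=> x; exists (e (inr x)); exists (inr x). Qed.

(** Each [d i] is [e (h i)] for some [h i] whose column is [(r k i)_k]. Hence [c] along [h] is
    itself one of the sources, and [d = e \o h]. *)
Lemma column_fun_satisfies n0 e (c : constraint A B) :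
  (forall j, consequent (column_constraint j) (e \o column_scheme j)) ->
  T c -> satisfies (column_fun n0 e) c.
Proof.
move=> eP Tc d [r Rr rd].
have [h hP] := choice (fun i => (exists2P _ _).1 (rd i)).
have hR k : antecedent c (column^~ k \o h).
  suff -> : column^~ k \o h = r k by exact: Rr.
  by apply/funext => i; have [/(congr1 (@^~ k))] := hP i.
have -> : d = e \o h by apply/funext => i; have [_ <-] := hP i.
exact: (eP (existT _ c (exist _ h (conj Tc hR)))).
Qed.

Lemma separating_multifun (m0 : (0 < m)%N) (n0 : (0 < n)%N)
    (S : set ('I_m -> B)) :
  T (unary_trivial A B) -> closed_conj_minors T ->
  ~ T (Constraint m0 (range a) S) ->
  exists f : multifun A B, [/\ mf_total f, forall c, T c -> satisfies f c
    & ~ satisfies f (Constraint m0 (range a) S)].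
Proof.
move=> Ttriv Tcm nT.
have [b [t [bt nSb]]] : exists (b : 'I_m -> B) (t : ('I_n -> A) -> B),
    (forall j, consequent (column_constraint j) (extend b t \o column_scheme j))
    /\ ~ S b.
  apply: contrapT => nex; apply: nT; apply: Tcm (conj_minor_column _ _).
  (* The family of a minor must be non-empty: the trivial constraint is a source along any map. *)
  - constructor; exists (unary_trivial A B).
    by exists (fun _ => inl (Ordinal m0)).
  - by case=> c [h []].
  - by move=> b t bt; apply: contrapT => nSb; apply: nex; exists b, t.
exists (column_fun n0 (extend b t)); split.
- exact: column_fun_total.
- by move=> c; exact: column_fun_satisfies.
(* The coordinate [i], as [inl i], has column [(a k i)_k] and value [b i], so [b] lies in the image
   of [range a]. *)
- move=> /(_ b) fS; apply/nSb/fS; exists a => [k|i]; first by exists k.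
  by exists (inl i).
Qed.

End Separation.

Unset Implicit Arguments.

Theorem theorem3 (A B : Type) (hA : inhabited A) (hB : inhabited B)
    (T : set (constraint A B)) :
  [/\ locally_closed T, T (unary_empty A B), T (unary_trivial A B)
    & closed_conj_minors T]
  <->
  (exists M : set (multifun A B),
     (forall f, M f -> mf_total f) /\ characterized_by T M).
Proof.
split=> [[Tloc Tempty Ttriv Tcm]|[M [Mt ->]]]; last first.
  split.
  - move=> c cP f Mf; apply: satisfies_finite_relaxations => c' /cP; exact.
  - by move=> f _; exact: satisfies_unary_empty.
  - by move=> f _ b.
  - move=> J F c _ FM cF f Mf; apply: satisfies_conj_minor cF; first exact: Mt.
    by move=> j; exact: FM.
(* This is the largest candidate for [M]; only the inclusion into [T] needs separation. *)
exists [set f | mf_total f /\ forall c, T c -> satisfies f c].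
split=> [f []//|]; apply/seteqP; split => [c Tc f [_]|c fc]; first exact.
apply: Tloc => _ [R' [S' [-> RR SS /finite_set_range_ord [n [a RE]]]]].
apply: contrapT => nT; case: n a RE => [|n] a RE; subst R'.
  apply: nT; have -> : range a = set0 by apply/seteqP; split => // x [[]].
  by apply: Tcm (conj_minor_unary_empty _ _ _).
have [f [ft fT]] := separating_multifun (ltn0Sn n) Ttriv Tcm nT.
by apply; apply: satisfies_relaxation => //; exact: fc.
Qed.
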